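(* Let $d\geq 2$ be an integer. If $A\subset\{1,2,\dots,N\}$ is such that every element of $A\hat{+}A$ is a perfect $d$-th power of an integer, then, as $N\to\infty$, $$|A|\leq\frac{(2+o(1))\phi(d)}{d}\log N,$$ i.e., for every $\varepsilon>0$ there is $N_0$ such that for all $N\ge N_0$ every such $A$ satisfies $|A|\le\frac{(2+\varepsilon)\phi(d)}{d}\log N$.
   Context: $A\hat{+}A=\{a+b: a,b\in A,\ a\neq b\}$; $\phi$ is Euler's totient function. *)

(* Defs.v *)
From HB Require Import structures.
From mathcomp Require Import all_boot all_order all_algebra finmap.
From mathcomp Require Import reals exp.

Set Implicit Arguments.
Unset Strict Implicit.
Unset Printing Implicit Defensive.

Local Open Scope fset_scope.

Definition restricted_sumset (A : {fset nat}) : {fset nat} :=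
  [fset (a + b)%N | a in A, b in A & a != b].

Definition perfect_power (d n : nat) : Prop :=
  exists k : int, (n%:Z = k ^+ d)%R.

Lemma restricted_sumsetP (A : {fset nat}) (s : nat) :
  reflect (exists a b, [/\ a \in A, b \in A, a != b & s = (a + b)%N])
          (s \in restricted_sumset A).
Proof.
apply: (iffP idP) => [/imfset2P[a /= aA [b]]|[a [b [aA bA ab ->]]]].
  by rewrite !inE /= => /andP[bA ab] ->; exists a, b.
by apply/imfset2P; exists a => //=; exists b; rewrite // !inE /= bA.
Qed.

(* Main.v *)
Require Import Defs.
From HB Require Import structures.
From mathcomp Require Import all_boot all_order all_algebra finmap.
From mathcomp Require Import perm boolp classical_sets functions reals topology.
From mathcomp Require Import normedtype derive sequences realfun exp.
From mathcomp Require Import ring lra zify.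
Import Order.TTheory GRing.Theory Num.Theory.
Import numFieldNormedType.Exports.
Local Open Scope fset_scope.
Local Open Scope ring_scope.

Set Implicit Arguments.
Unset Strict Implicit.
Unset Printing Implicit Defensive.

(**
Put [alpha = 1/d] and let [K = |A|/2].  Split the increasing enumeration of [A] into its lower
half [a_1 < ... < a_K] and the next [K] elements [b_1 < ... < b_K].  All the numbers
[(a_i + b_j)^alpha] are integers, so their determinant is an integer.

It is nonzero: by Rolle's theorem a nontrivial combination of [K] functions
[x |-> (x + a_i)^alpha] has fewer than [K] positive zeros.  Hence its absolute value is at least 1.

It is small: if [y] separates the two halves, suitable Moebius coordinates [u_i] of [a_i] and
[v_j] of [b_j] satisfy [|u_i| <= 3/17], [|v_j| <= 1] and
[(a_i + b_j)^alpha = f_i g_j (1 - u_i v_j)^alpha] with [f_i g_j <= 4 N^alpha].  Expanding the last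
factor in powers of [u_i v_j], grouping the exponents by parity and expanding [v_j^2] around [1/2]
writes the kernel as a sum of rank-one terms, the [k]-th of size [O(s^(k/2))] with
[s = 9/569 < exp(-4)].  Since a rank-one term can serve only one row of the determinant, the
determinant is at most [(O(K^3) N^alpha)^K exp(-K(K-2))].

Together, [K <= (log N)/d + O(log K)], that is [|A| <= (2 + o(1)) (log N)/d], which is enough as
[phi(d) >= 1].
*)

(** * Taylor polynomials of [(1 - x)^b] and their remainder *)

(* [binc b n] is the [n]-th Taylor coefficient of [(1 - x)^b] at 0. *)
Fixpoint binc (R : realType) (b : R) (n : nat) : R :=
  if n is m.+1 then - b / m.+1%:R * binc (b - 1) m else 1.

Lemma bincS (R : realType) (b : R) n :
  binc b n.+1 = binc b n * (n%:R - b) / n.+1%:R.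
Proof.
elim: n b => [|n IH] b; first by rewrite /=; field.
rewrite [LHS]/= -/(binc _ n.+1) IH [binc b n.+1]/= -(natr1 n) -(natr1 n.+1) -(natr1 n).
have n0 : 0 <= n%:R :> R by [].
by field; apply/andP; split; lra.
Qed.

Lemma norm_binc_le1 (R : realType) (b : R) n : 0 <= b <= 1 -> `|binc b n| <= 1.
Proof.
move=> /andP[b0 b1]; elim: n => [|n IH]; first by rewrite normr1.
have n0 : 0 <= n%:R :> R by [].
have h : `|(n%:R - b) / n.+1%:R| <= 1.
  rewrite normrM normfV normr_nat ler_pdivrMr ?ltr0n// mul1r ler_norml -natr1.
  by apply/andP; split; lra.
by rewrite bincS -mulrA normrM mulr_ile1.
Qed.

Lemma MVT_itv0 (R : realType) (f df : R -> R) (x : R) : 0 < x ->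
    (forall t, 0 <= t <= x -> is_derive t 1 f (df t)) ->
  exists2 c, 0 < c < x & f x - f 0 = df c * x.
Proof.
move=> x0 fdf.
have [c cx ->] : exists2 c, c \in `]0, x[ & f x - f 0 = df c * (x - 0).
  apply: MVT => // [t|].
    by rewrite in_itv /= => /andP[t0 tx]; apply: fdf; rewrite !ltW.
  apply: derivable_within_continuous => t; rewrite in_itv /= => tx.
  exact: (@ex_derive _ _ _ _ _ _ _ (fdf t tx)).
by exists c; [move: cx; rewrite in_itv | rewrite subr0].
Qed.

(** A substitute for integrating the bound on [df]. For [s = 1] and [s = -1], the function
    [D * t^(m+1) - s * f t] vanishes at 0 and has nonnegative derivative on [[0, r]], so the mean
    value theorem applies. Negative [x] are reached by composing with [t |-> - t]. *)
Lemma norm_le_of_derive_le (R : realType) (f df : R -> R) (r D : R) (m : nat) :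
    (forall t : R, `|t| <= r -> is_derive t 1 f (df t)) ->
    (forall t : R, `|t| <= r -> `|df t| <= m.+1%:R * D * `|t| ^+ m) -> f 0 = 0 ->
  forall x, `|x| <= r -> `|f x| <= D * `|x| ^+ m.+1.
Proof.
have main (s : R) (g dg : R -> R) (x : R) : 0 <= x <= r -> `|s| = 1 ->
    (forall t : R, 0 <= t <= r -> is_derive t 1 g (dg t)) ->
    (forall t : R, 0 <= t <= r -> `|dg t| <= m.+1%:R * D * t ^+ m) -> g 0 = 0 ->
  s * g x <= D * x ^+ m.+1.
  move=> /andP[]; rewrite le_eqVlt => /predU1P[<- _ _ _ _ ->|x0 xr s1 gdg dgb g0].
    by rewrite mulr0 expr0n mulr0.
  pose p : {poly R} := D *: 'X^(m.+1).
  pose h t := p.[t] - s * g t.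
  have [|c /andP[c0 cx]] := @MVT_itv0 _ h (fun t => m.+1%:R * D * t ^+ m - s * dg t) _ x0.
    move=> t /andP[t0 tx]; have tr : 0 <= t <= r by rewrite t0 (le_trans tx).
    apply: (is_derive_eq (is_deriveB (is_derive_poly p t) (is_deriveZ s (gdg _ tr)))).
    rewrite /p derivZ derivXn /= hornerZ hornerMn hornerXn /GRing.scale /=.
    by rewrite -mulr_natr; ring.
  rewrite /h /p !hornerZ !hornerXn g0 expr0n !mulr0 !subr0 => hx.
  rewrite -subr_ge0 hx mulr_ge0 ?(ltW x0)// subr_ge0.
  have cr : 0 <= c <= r by rewrite (ltW c0) (le_trans (ltW cx)).
  apply: le_trans (dgb c cr).
  by rewrite (le_trans (ler_norm _))// normrM s1 mul1r.
move=> fdf dfb f0 x xr.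
have xx : 0 <= `|x| <= r by rewrite normr_ge0.
have ext (s : R) t : s = 1 \/ s = -1 -> 0 <= t <= r -> `|s * t| <= r.
  by move=> hs /andP[t0 tr]; case: hs => ->; rewrite ?mul1r ?mulN1r ?normrN ger0_norm.
have [e he ex] : exists2 e : R, e = 1 \/ e = -1 & x = e * `|x|.
  have [x0|x0] := lerP 0 x.
    by exists 1; [left|rewrite mul1r ger0_norm].
  by exists (-1); [right|rewrite mulN1r ltr0_norm// opprK].
have key (s : R) : `|s| = 1 -> s * f x <= D * `|x| ^+ m.+1.
  move=> s1; rewrite {1}ex; apply: (main s (fun t => f (e * t)) (fun t => e * df (e * t))) => //.
  - move=> t tr; have fd := fdf _ (ext _ _ he tr).
    have ed : is_derive t 1 (fun t => e * t) e.
      by apply: is_derive_eq; rewrite /= /GRing.scale /= ; ring.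
    rewrite mulrC; exact: (@is_derive1_comp _ f (fun t => e * t)).
  - move=> t tr; rewrite normrM.
    have -> : `|e| = 1 by case: he => ->; rewrite ?normrN normr1.
    rewrite mul1r; apply: (le_trans (dfb _ (ext _ _ he tr))).
    have t0 : 0 <= t by case/andP: tr.
    by rewrite normrM (ger0_norm t0); case: he => ->; rewrite ?normrN normr1 mul1r.
  - by rewrite mulr0.
have k1 := key 1 (normr1 _); have k2 := key (-1) _.
rewrite ler_norml; apply/andP; split; last by rewrite mul1r in k1.
by rewrite lerNl -mulN1r k2// normrN normr1.
Qed.

Definition binpoly (R : realType) (b : R) (m : nat) : {poly R} :=
  \poly_(n < m) binc b n.

Lemma deriv_binpoly (R : realType) (b : R) m :
  (binpoly b m.+1)^`() = - b *: binpoly (b - 1) m.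
Proof.
apply/polyP => n; rewrite coef_deriv coefZ !coef_poly ltnS.
case: ltnP => _; last by rewrite mul0rn mulr0.
by rewrite -mulr_natr /= mulrAC divfK ?pnatr_eq0.
Qed.

(** Induction on [m]: differentiating the remainder for [(b, m+1)] gives [- b] times the one for
    [(b - 1, m)]. The exponent [b - (m+1) = (b - 1) - m] is the same for both, so a single [C]
    serves throughout. *)
Lemma binomial_remainder (R : realType) (r C b : R) m : r < 1 ->
    (forall x, `|x| <= r -> (1 - x) `^ (b - m%:R) <= C) ->
  forall x, `|x| <= r ->
    `|(1 - x) `^ b - (binpoly b m).[x]| <= `|binc b m| * C * `|x| ^+ m.
Proof.
move=> r1; elim: m b => [|m IH] b Cb x xr.
  rewrite /binpoly poly_def big_ord0 horner0 subr0 expr0 mulr1 /= normr1 mul1r.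
  by have := Cb x xr; rewrite subr0 ger0_norm ?powR_ge0.
pose df t := - b * ((1 - t) `^ (b - 1) - (binpoly (b - 1) m).[t]).
apply: (@norm_le_of_derive_le _ (fun x => (1 - x) `^ b - (binpoly b m.+1).[x])
  df r) => // [t tr|t tr|].
- have t1 : 0 < 1 - t by move: tr; rewrite ler_norml => /andP[]; lra.
  have pd := is_derive1_powR b t1.
  have sd : is_derive t 1 (fun t : R => 1 - t) (-1).
    by apply: (is_derive_eq (is_deriveB (is_derive_cst (1 : R) t 1)
      (is_derive_id t 1))); rewrite sub0r.
  have cd := @is_derive1_comp _ _ (fun t : R => 1 - t) _ _ _ pd sd.
  have qd := is_derive_poly (binpoly b m.+1) t.
  have := is_deriveB cd qd; rewrite /comp /=.
  move=> H; apply: (is_derive_eq H).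
  by rewrite deriv_binpoly hornerZ /df; ring.
- rewrite /df normrM normrN /=.
  have Cb' y : `|y| <= r -> (1 - y) `^ (b - 1 - m%:R) <= C.
    by move=> yr; have := Cb y yr; rewrite -natr1 opprD addrA addrAC.
  apply: (le_trans (ler_wpM2l _ (IH _ Cb' t tr))) => //.
  rewrite !normrM normrN normfV normr_nat.
  rewrite -(mulrA _ _ C) [X in X <= _]mulrA !mulrA le_eqVlt; apply/orP; left.
  by apply/eqP; field; rewrite nat1r pnatr_eq0.
- rewrite subr0 powR1 horner_coef0 /binpoly coef_poly /=; exact: subrr.
Qed.

(** * Zeros of sums of shifted powers and nonvanishing of the determinant *)

Lemma Rolle_path (R : realType) (f df : R -> R) :
    (forall x : R, 0 < x -> is_derive x 1 f (df x)) ->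
  forall z zs, 0 < z -> f z = 0 -> path <%R z zs -> all (fun x => f x == 0) zs ->
  exists ws, [/\ size ws = size zs, path <%R z ws & all (fun x => df x == 0) ws].
Proof.
move=> fdf z zs; elim: zs z => [|y zs IH] z z0 fz /=; first by exists [::].
move=> /andP[zy pzs] /andP[/eqP fy fzs].
have [ws [sws pws dws]] := IH y (lt_trans z0 zy) fy pzs fzs.
have der x : z <= x -> derivable f x 1.
  by move=> zx; exact: (@ex_derive _ _ _ _ _ _ _ (fdf x (lt_le_trans z0 zx))).
have [||//||c] := @Rolle R f z y.
- by [].
- by move=> x; rewrite in_itv => /andP[/ltW zx _]; exact: der.
- apply: derivable_within_continuous => x; rewrite in_itv => /andP[zx _].
  exact: der.
- by rewrite fz fy.
rewrite in_itv /= => /andP[zc cy] dc; exists (c :: ws); split => /=.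
- by rewrite sws.
- by rewrite zc; exact: (path_le lt_trans cy).
- rewrite dws andbT; have := @derive_val _ _ _ _ _ _ _ dc.
  by rewrite (@derive_val _ _ _ _ _ _ _ (fdf c (lt_trans z0 zc))) => ->.
Qed.

(** Each pair of [l] holds a coefficient and a shift. *)
Definition shifted_powers (R : realType) (l : seq (R * R)) (b x : R) : R :=
  \sum_(p <- l) p.1 * (x + p.2) `^ b.

Lemma is_derive_shifted_powers (R : realType) (l : seq (R * R)) (b x : R) :
    all (fun p => 0 <= p.2) l -> 0 < x ->
  is_derive x 1 (shifted_powers l b) (b * shifted_powers l (b - 1) x).
Proof.
move=> + x0; elim: l => [_|p l IH /= /andP[p0 lp]].
  have -> : shifted_powers [::] b = cst 0 by apply/funext => y; rewrite /shifted_powers big_nil.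
  by rewrite /shifted_powers big_nil mulr0; exact: is_derive_cst.
have -> : shifted_powers (p :: l) b =
    (fun y => p.1 *: (y + p.2) `^ b) + shifted_powers l b.
  by apply/funext => y; rewrite /shifted_powers big_cons.
have xp : 0 < x + p.2 by rewrite ltr_wpDr.
have sd : is_derive x 1 (fun y : R => y + p.2) 1.
  by apply: (is_derive_eq (is_deriveD (is_derive_id x 1)
    (is_derive_cst p.2 x 1))); rewrite addr0.
have cd := @is_derive1_comp _ _ (fun y : R => y + p.2) _ _ _ (is_derive1_powR b xp) sd.
apply: (is_derive_eq (is_deriveD (is_deriveZ p.1 cd) (IH lp))).
by rewrite /shifted_powers big_cons /GRing.scale /=; ring.
Qed.

(* Dividing by one of the powers and differentiating removes that term and lowers the exponent. *)
Lemma shifted_powers_zeros (R : realType) (l : seq (R * R)) (b z : R) (zs : seq R) :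
    b < 1 -> b != 0 -> uniq (map snd l) -> all (fun p => 0 <= p.2) l ->
    all (fun p => p.1 != 0) l -> (0 < size l)%N -> 0 < z -> path <%R z zs ->
    shifted_powers l b z = 0 -> all (fun x => shifted_powers l b x == 0) zs ->
  ((size zs).+1 < size l)%N.
Proof.
have [n] := ubnP (size l); elim: n l b z zs => // n IH [|p [|q l']] b z zs //.
  move=> _ _ _ _ /= /andP[p0 _] /andP[p1 _] _ z0 _.
  rewrite /shifted_powers big_seq1 => /eqP; rewrite mulf_eq0 (negbTE p1) /= => /eqP/powR_eq0_eq0 h.
  have : 0 < z + p.2 by rewrite ltr_wpDr.
  by rewrite h ltxx.
have : (0 < size (q :: l'))%N by [].
move: (q :: l') => l l0; rewrite /= ltnS => sl b1 b0 /andP[pl ul] /andP[p0 lp0] /andP[p1 lp1].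
move=> _ z0 pzs gz gzs.
case: zs => [|y zs] in pzs gzs *; first by rewrite /= !ltnS.
(* In [F] the term of [p] has become constant. Differentiating [((x + r) / (x + p))^b] gives
   [b (p - r) (x + r)^(b-1) (x + p)^(-b-1)], which explains the new coefficients in [l1]. *)
pose l1 := [seq (r.1 * (p.2 - r.2), r.2) | r <- l].
pose F x := shifted_powers (p :: l) b x * (x + p.2) `^ (- b).
pose dF x := (x + p.2) `^ (- b - 1) * (b * shifted_powers l1 (b - 1) x).
have FdF (x : R) : 0 < x -> is_derive x 1 F (dF x).
  move=> x0; have xp : 0 < x + p.2 by rewrite ltr_wpDr.
  have sd : is_derive x 1 (fun y : R => y + p.2) 1.
    by apply: (is_derive_eq (is_deriveD (is_derive_id x 1)
      (is_derive_cst p.2 x 1))); rewrite addr0.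
  have cd := @is_derive1_comp _ _ (fun y : R => y + p.2) _ _ _ (is_derive1_powR (- b) xp) sd.
  have pl0 : all (fun p => 0 <= p.2) (p :: l) by rewrite /= p0.
  have gd := is_derive_shifted_powers b pl0 x0.
  apply: (is_derive_eq (is_deriveM gd cd)).
  rewrite /dF /GRing.scale /=.
  have -> : (x + p.2) `^ (- b) = (x + p.2) * (x + p.2) `^ (- b - 1).
    rewrite -{2}(@powRr1 _ (x + p.2)) ?(ltW xp)// -powRD ?(gt_eqF xp) ?implybT//.
    by congr (_ `^ _); ring.
  have -> : shifted_powers l1 (b - 1) x =
      (x + p.2) * shifted_powers (p :: l) (b - 1) x - shifted_powers (p :: l) b x.
    rewrite /shifted_powers big_map !big_cons mulrDr.
    have pw r : 0 <= r -> (x + r) `^ b = (x + r) * (x + r) `^ (b - 1).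
      move=> r0; have xr : 0 < x + r by rewrite ltr_wpDr.
      rewrite -{2}(@powRr1 _ (x + r)) ?(ltW xr)// -powRD ?(gt_eqF xr) ?implybT//.
      by congr (_ `^ _); ring.
    have -> : \sum_(r <- l) r.1 * (x + r.2) `^ b =
        \sum_(r <- l) r.1 * ((x + r.2) * (x + r.2) `^ (b - 1)).
      by apply: eq_big_seq => r rl; rewrite -pw// (allP lp0).
    have -> : \sum_(r <- l) r.1 * (p.2 - r.2) * (x + r.2) `^ (b - 1) =
        (x + p.2) * (\sum_(r <- l) r.1 * (x + r.2) `^ (b - 1)) -
        \sum_(r <- l) r.1 * ((x + r.2) * (x + r.2) `^ (b - 1)).
      by rewrite mulr_sumr -sumrB; apply: eq_bigr => r _; ring.
    by rewrite (pw _ p0); ring.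
  by ring.
have zF x : shifted_powers (p :: l) b x = 0 -> F x = 0 by rewrite /F => ->; rewrite mul0r.
have [|w_s [sws pws dws]] := Rolle_path FdF z0 (zF _ gz) pzs.
  by apply: sub_all gzs => x /eqP/zF ->.
case: w_s => [|w ws] // in sws pws dws *.
move: sws => [sws]; move: pws => /= /andP[zw pws].
have w0 : 0 < w := lt_trans z0 zw.
have dFz x : 0 < x -> dF x == 0 -> shifted_powers l1 (b - 1) x == 0.
  move=> x0; rewrite /dF !mulf_eq0 (negbTE b0) /= powR_eq0.
  by rewrite gt_eqF ?ltr_wpDr.
move: dws => /= /andP[dw dws].
(* The condition [b < 1] passes to [b - 1] and also yields [b - 1 != 0]; the new coefficients are
   nonzero because the shifts are distinct. *)
have := IH l1 (b - 1) w ws; rewrite size_map sws ltnS; apply => //.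
- by lra.
- by lra.
- by rewrite -map_comp.
- by rewrite all_map.
- rewrite all_map; apply/allP => r rl /=; rewrite mulf_neq0 ?(allP lp1)// subr_eq0.
  by apply: contraNneq pl => ->; apply: map_f.
- exact/eqP/dFz.
- apply/allP => x xws; apply: dFz; last exact: (allP dws).
  apply: (lt_trans w0); have := pws; rewrite (path_sortedE lt_trans) => /andP[/allP + _].
  exact.
Qed.

(** A nonzero vector in the left kernel would give a sum of at most [K] shifted powers that vanishes
    at the [K] distinct points [c j]. *)
Lemma det_shifted_powers_neq0 (R : realType) K (a c : 'I_K -> R) (b : R) :
    b < 1 -> b != 0 -> injective a -> injective c ->
    (forall i, 0 < a i) -> (forall i, 0 < c i) ->
  \det (\matrix_(i, j) (a i + c j) `^ b) != 0.
Proof.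
move=> b1 b0 ainj cinj a0 c0; apply/negP => /det0P[v v0 vM].
(* Zero coordinates are dropped, since the count of zeros requires nonzero coefficients. *)
pose l := [seq (v 0 i, a i) | i <- enum 'I_K & v 0 i != 0].
have zero j : shifted_powers l b (c j) = 0.
  have /matrixP/(_ 0 j) := vM; rewrite !mxE => vMj; apply: etrans vMj.
  rewrite /shifted_powers big_map big_filter big_mkcond big_enum /=.
  apply: eq_bigr => i _; rewrite mxE addrC.
  by case: eqVneq => [->|]; rewrite ?mul0r.
pose s := sort <=%R [seq c j | j <- enum 'I_K].
have ss : size s = K by rewrite size_sort size_map size_enum_ord.
have sm x : x \in s -> exists j, x = c j.
  by rewrite mem_sort => /mapP[j _ ->]; exists j.
have us : sorted <%R s.
  rewrite lt_sorted_uniq_le sort_uniq map_inj_uniq// enum_uniq.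
  exact: sort_le_sorted.
have l0 : (0 < size l)%N.
  rewrite size_map lt0n; apply: contra v0 => /nilP h; apply/eqP/rowP => i; rewrite !mxE.
  apply/eqP/negPn/negP => vi; have : i \in [seq i <- enum 'I_K | v 0 i != 0].
    by rewrite mem_filter vi mem_enum.
  by rewrite h.
have lK : (size l <= K)%N.
  by rewrite size_map size_filter (leq_trans (count_size _ _))// size_enum_ord.
case: s => [|z zs] in ss sm us *; first by move: (leq_trans l0 lK); rewrite -ss.
suff : ((size zs).+1 < size l)%N by rewrite -[(size zs).+1]/(size (z :: zs)) ss ltnNge lK.
have [j zj] := sm z (mem_head _ _).
apply: (@shifted_powers_zeros _ l b z zs) => //.
- rewrite -map_comp map_inj_uniq// filter_uniq// enum_uniq//.
- by apply/allP => p /mapP[i _ ->] /=; exact: ltW.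
- by apply/allP => p /mapP[i]; rewrite mem_filter => /andP[vi _] ->.
- by rewrite zj.
- by rewrite zj.
- apply/allP => x xzs; have [k ->] := sm x (mem_behead (s := z :: zs) xzs).
  exact/eqP.
Qed.

(** * Determinants of sums of rank-one matrices *)

Section DeterminantBound.
Variables (R : realType) (K : nat).

Lemma det_sum_rows (J : finType) (T : J -> 'I_K -> 'I_K -> R) :
  \det (\matrix_(i, j) \sum_k T k i j) =
  \sum_(g : {ffun 'I_K -> J}) \det (\matrix_(i, j) T (g i) i j).
Proof.
rewrite /determinant exchange_big /=; apply: eq_bigr => s _.
rewrite -mulr_sumr; congr (_ * _).
under eq_bigr do rewrite mxE.
rewrite bigA_distr_bigA /=; apply: eq_bigr => g _.
by apply: eq_bigr => i _; rewrite mxE.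
Qed.

Lemma norm_det_le (M : 'M[R]_K) (t : 'I_K -> R) :
  (forall i j, `|M i j| <= t i) -> `|\det M| <= K`!%:R * \prod_i t i.
Proof.
move=> Mt; apply: (le_trans (ler_norm_sum _ _ _)).
have : \sum_(s : 'S_K) \prod_i t i = K`!%:R * \prod_i t i.
  by rewrite sumr_const card_Sn mulr_natl.
move=> <-; apply: ler_sum => s _.
rewrite normrM normrX normrN1 expr1n mul1r normr_prod.
by apply: ler_prod => i _; rewrite normr_ge0 Mt.
Qed.

Lemma det_proportional_rows (M : 'M[R]_K) i1 i2 (f1 f2 : R) (h : 'I_K -> R) :
    i1 != i2 -> (forall j, M i1 j = f1 * h j) -> (forall j, M i2 j = f2 * h j) ->
  \det M = 0.
Proof.
move=> i12 M1 M2; apply/eqP/det0P.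
have [f20|f20] := eqVneq f2 0.
  exists (delta_mx 0 i2).
    by apply/eqP => /matrixP/(_ 0 i2)/eqP; rewrite !mxE !eqxx oner_eq0.
  by rewrite -rowE; apply/rowP => j; rewrite !mxE M2 f20 mul0r.
exists (f2 *: delta_mx 0 i1 - f1 *: delta_mx 0 i2).
  apply/eqP => /matrixP/(_ 0 i1)/eqP.
  by rewrite !mxE !eqxx (negbTE i12) /= mulr1 mulr0 subr0 (negbTE f20).
rewrite mulmxBl -!scalemxAl -!rowE; apply/rowP => j; rewrite !mxE M1 M2; ring.
Qed.

End DeterminantBound.

(* In the expansion by rows every rank-one term can be used for one row only; the remaining rows
   use the last term, which is the smallest one. *)
Lemma norm_det_rank_one_sum_le (R : realType) K (T : 'I_K.+1 -> 'I_K.+1 -> 'I_K.+1 -> R)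
    (f h : 'I_K.+1 -> 'I_K.+1 -> R) (t : 'I_K.+1 -> R) :
    (forall k i j, k != ord_max -> T k i j = f k i * h k j) ->
    (forall k i j, `|T k i j| <= t k) -> (forall k, t ord_max <= t k) ->
  `|\det (\matrix_(i, j) \sum_k T k i j)| <=
    (K.+1 ^ K.+1)%:R * (K.+1)`!%:R * \prod_k t k.
Proof.
move=> Tfh Tt tmax.
have t0 k : 0 <= t k by apply: le_trans (Tt k ord0 ord0).
have P0 : 0 <= \prod_k t k by apply: prodr_ge0.
rewrite det_sum_rows (le_trans (ler_norm_sum _ _ _))//.
have : \sum_(g : {ffun 'I_K.+1 -> 'I_K.+1}) ((K.+1)`!%:R * \prod_k t k) =
    (K.+1 ^ K.+1)%:R * (K.+1)`!%:R * \prod_k t k.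
  by rewrite sumr_const card_ffun card_ord -mulrA [RHS]mulr_natl.
move=> <-; apply: ler_sum => g _.
(* [S] is the set of rows that use a rank-one term. If two of them use the same term, they are
   proportional and the determinant vanishes. *)
pose S := [set i | g i != ord_max].
have [ginj|] := boolP [forall i1 in S, forall i2 in S, (g i1 == g i2) ==> (i1 == i2)]; last first.
  rewrite negb_forall_in => /exists_inP[i1 i1S]; rewrite negb_forall_in => /exists_inP[i2 i2S].
  rewrite negb_imply => /andP[/eqP g12 i12].
  rewrite (@det_proportional_rows _ _ _ i1 i2 (f (g i1) i1) (f (g i1) i2) (h (g i1))) //.
  - by rewrite normr0 mulr_ge0.
  - by move=> j; rewrite mxE Tfh//; rewrite inE in i1S.
  - by move=> j; rewrite mxE -g12 Tfh//; rewrite inE in i1S.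
have {}ginj : {in S &, injective g}.
  move=> i1 i2 i1S i2S /eqP g12; apply/eqP.
  by have /forall_inP/(_ _ i1S)/forall_inP/(_ _ i2S)/implyP/(_ g12) := ginj.
apply: (le_trans (@norm_det_le _ _ _ (fun i => t (g i)) _)).
  by move=> i j; rewrite mxE.
apply: ler_wpM2l => //.
(* The rows in [S] match the indices in [g @: S]. The other rows contribute [t ord_max] each and are
   as many as the indices outside [g @: S], where [t k] is at least [t ord_max]. *)
rewrite (bigID (mem S)) /= [leRHS](bigID (mem (g @: S))) /=.
rewrite (big_imset _ ginj) /=; apply: ler_wpM2l; first exact: prodr_ge0.
have -> : \prod_(i | i \notin S) t (g i) = \prod_(i in ~: S) t ord_max.
  apply: eq_big => [i|i]; first by rewrite !inE.
  by rewrite inE negbK => /eqP ->.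
have -> : \prod_(k | k \notin g @: S) t k = \prod_(k in ~: (g @: S)) t k.
  by apply: eq_bigl => k; rewrite !inE.
have cS : #|~: S| = #|~: (g @: S)|.
  by apply/eqP; rewrite -(eqn_add2l #|S|) cardsC -(card_in_imset ginj) cardsC.
rewrite prodr_const cS -prodr_const; apply: ler_prod => k _.
by rewrite t0 tmax.
Qed.

(** * Rank-one expansion of the kernel [(1 - u v)^b] *)

Lemma sum_double (V : nmodType) (F : nat -> V) T :
  \sum_(k < T.*2) F k = \sum_(j < T) (F j.*2 + F j.*2.+1).
Proof.
elim: T => [|T IH]; first by rewrite !big_ord0.
by rewrite doubleS !big_ord_recr /= IH addrA.
Qed.

Lemma exprDn_widen (R : comPzRingType) (x y : R) n T : (n < T)%N ->
  (x + y) ^+ n = \sum_(i < T) 'C(n, i)%:R * x ^+ (n - i) * y ^+ i.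
Proof.
move=> nT; rewrite exprDn (big_ord_widen T (fun i => x ^+ (n - i) * y ^+ i *+ 'C(n, i)) nT).
rewrite big_mkcond; apply: eq_bigr => i _; case: ltnP => ni.
  by rewrite -mulr_natl mulrA.
by rewrite bin_small// !mul0r.
Qed.

(** The right-hand side is the full generating series; Pascal's rule gives the induction on [T], for
    all [j] at once. *)
Lemma sum_bin_exp_le (R : realType) (t : R) T j : 0 <= t < 1 ->
  \sum_(n < T) 'C(n, j)%:R * t ^+ n <= t ^+ j / (1 - t) ^+ j.+1.
Proof.
move=> /andP[t0 t1]; have t1' : 0 < 1 - t by lra.
have t1n : 1 - t != 0 by lra.
elim: T j => [|T IH] [|j].
- by rewrite big_ord0 divr_ge0 ?exprn_ge0 // ltW.
- by rewrite big_ord0 divr_ge0 ?exprn_ge0 // ltW.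
- have -> : t ^+ 0 / (1 - t) ^+ 1 = 1 + t * (t ^+ 0 / (1 - t) ^+ 1) by field.
  rewrite big_ord_recl bin0 mulr1 expr0 lerD2l.
  apply: le_trans (ler_wpM2l t0 (IH 0%N)); rewrite mulr_sumr; apply: ler_sum => n _.
  by rewrite !bin0 !mul1r /= exprS.
- have -> : t ^+ j.+1 / (1 - t) ^+ j.+2 =
      t * (t ^+ j.+1 / (1 - t) ^+ j.+2 + t ^+ j / (1 - t) ^+ j.+1).
    by rewrite !exprS; field; rewrite expf_neq0// t1n.
  rewrite big_ord_recl bin0n mul0r add0r.
  apply: le_trans (ler_wpM2l t0 (lerD (IH j.+1) (IH j))).
  rewrite -big_split mulr_sumr; apply: ler_sum => n _.
  by rewrite /= binS natrD exprS mulrDl !mulrDr !mulrA ![_ * t]mulrC.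
Qed.

(** The index [k] encodes a parity [e = odd k] and a degree [j = k./2]. In the terms of exponent
    [2n + e], one expands [v^(2n) = (1/2 + (v^2 - 1/2))^n]; this is the coefficient of
    [v^e (v^2 - 1/2)^j]. For [n < j] the binomial coefficient is 0, so the truncated [n - k./2] is
    harmless. *)
Definition left_factor (R : realType) (c : nat -> R) (T k : nat) (u : R) : R :=
  u ^+ odd k *
  \sum_(n < T) c (n.*2 + odd k)%N * ('C(n, k./2)%:R * 2^-1 ^+ (n - k./2)) * u ^+ n.*2.

Definition right_factor (R : realType) (k : nat) (v : R) : R :=
  v ^+ odd k * (v ^+ 2 - 2^-1) ^+ k./2.

Lemma sum_parity_class (R : realType) (c : nat -> R) T (e : bool) (u v : R) :
  \sum_(j < T) (u ^+ e * (\sum_(n < T) c (n.*2 + e)%N *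
      ('C(n, j)%:R * 2^-1 ^+ (n - j)) * u ^+ n.*2) * (v ^+ e * (v ^+ 2 - 2^-1) ^+ j)) =
  \sum_(n < T) c (n.*2 + e)%N * (u * v) ^+ (n.*2 + e).
Proof.
under eq_bigr do rewrite mulr_sumr mulr_suml.
rewrite exchange_big /=; apply: eq_bigr => n _.
have -> : (u * v) ^+ (n.*2 + e) = u ^+ e * u ^+ n.*2 * v ^+ e * (2^-1 + (v ^+ 2 - 2^-1)) ^+ n.
  by rewrite addrC subrK -exprM mul2n exprD !exprMn; ring.
rewrite (exprDn_widen _ _ (ltn_ord n)) !mulr_sumr.
by apply: eq_bigr => j _; ring.
Qed.

Lemma sum_factors (R : realType) (c : nat -> R) T (u v : R) :
  \sum_(k < T.*2) left_factor c T k u * right_factor k v =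
  \sum_(n < T.*2) c n * (u * v) ^+ n.
Proof.
rewrite (sum_double (fun k => left_factor c T k u * right_factor k v)).
rewrite (sum_double (fun n => c n * (u * v) ^+ n)) !big_split /=; congr (_ + _).
- transitivity (\sum_(n < T) c (n.*2 + false)%N * (u * v) ^+ (n.*2 + false)); last first.
    by apply: eq_bigr => n _; rewrite addn0.
  rewrite -sum_parity_class; apply: eq_bigr => j _.
  by rewrite /left_factor /right_factor odd_double doubleK.
- transitivity (\sum_(n < T) c (n.*2 + true)%N * (u * v) ^+ (n.*2 + true)); last first.
    by apply: eq_bigr => n _; rewrite addn1.
  rewrite -sum_parity_class; apply: eq_bigr => j _.
  by rewrite /left_factor /right_factor /= odd_double /= uphalf_double.
Qed.

(** Since [|v^2 - 1/2| <= 1/2], the powers of [1/2] combine to [2^-n], leaving the series of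
    ['C(n, j) t^n] with [t = (3/17)^2 / 2 = 9/578]. Its sum is at most [578/569 * (9/569)^j],
    because [t / (1 - t) = 9/569]. *)
Lemma norm_factors_le (R : realType) (c : nat -> R) T k (u v : R) :
    (forall n, `|c n| <= 1) -> `|u| <= 3 / 17 -> `|v| <= 1 ->
  `|left_factor c T k u * right_factor k v| <= 2 * (9 / 569) ^+ k./2.
Proof.
move=> c1 ur v1; set j := k./2.
have u1 : `|u| <= 1 by lra.
have h2 : 0 <= 2^-1 :> R by lra.
have v2 : `|v ^+ 2 - 2^-1| <= 2^-1.
  have v20 : 0 <= v ^+ 2 by exact: sqr_ge0.
  have : v ^+ 2 <= 1 by rewrite -real_normK ?num_real// exprn_ile1.
  by rewrite ler_norml => h; apply/andP; split; lra.
have e1 (x : R) (e : bool) : `|x| <= 1 -> `|x ^+ e| <= 1.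
  by case: e => h; rewrite ?expr0 ?normr1// expr1.
have sumb : `|\sum_(n < T) c (n.*2 + odd k)%N * ('C(n, j)%:R * 2^-1 ^+ (n - j)) * u ^+ n.*2|
    * 2^-1 ^+ j <= 2 * (9 / 569) ^+ j.
  apply: (@le_trans _ _ (\sum_(n < T) 'C(n, j)%:R * (9 / 578 : R) ^+ n)); last first.
    apply: (le_trans (sum_bin_exp_le T j _)); first by apply/andP; split; lra.
    have -> : (9 / 578 : R) ^+ j / (1 - 9 / 578) ^+ j.+1 = 578 / 569 * (9 / 569) ^+ j.
      have -> : 1 - 9 / 578 = 569 / 578 :> R by lra.
      rewrite exprS invfM mulrCA -expr_div_n.
      by congr (_ * _ ^+ _); field.
    by apply: ler_wpM2r; [rewrite exprn_ge0//; lra | lra].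
  apply: (le_trans (ler_wpM2r _ (ler_norm_sum _ _ _))); first by rewrite exprn_ge0.
  rewrite mulr_suml; apply: ler_sum => n _.
  have [nj|jn] := ltnP n j; first by rewrite bin_small// !(mul0r, mulr0) normr0 mul0r.
  rewrite !normrM normr_nat (ger0_norm (exprn_ge0 _ h2)) normrX.
  have -> : `|c (n.*2 + odd k)%N| * ('C(n, j)%:R * 2^-1 ^+ (n - j)) * `|u| ^+ n.*2 * 2^-1 ^+ j =
      `|c (n.*2 + odd k)%N| * ('C(n, j)%:R * ((`|u| ^+ 2) / 2) ^+ n).
    have -> : (`|u| ^+ 2 / 2) ^+ n = `|u| ^+ n.*2 * (2^-1 ^+ (n - j) * 2^-1 ^+ j).
      by rewrite -exprD subnK// exprMn -exprM mul2n.
    by ring.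
  rewrite -[leRHS]mul1r; apply: ler_pM => //.
    by rewrite mulr_ge0// exprn_ge0// divr_ge0// exprn_ge0.
  apply: ler_wpM2l => //; apply: lerXn2r; rewrite ?nnegrE ?divr_ge0 ?exprn_ge0//.
  have h : `|u| ^+ 2 <= (3 / 17) ^+ 2 by apply: lerXn2r; rewrite ?nnegrE//; lra.
  by lra.
rewrite /left_factor /right_factor -/j !normrM !normrX.
rewrite (_ : forall a b c d : R, a * b * (c * d) = (a * c) * (b * d)); last by move=> *; ring.
rewrite -[leRHS]mul1r; apply: ler_pM => //.
- by rewrite mulr_ge0// exprn_ge0.
- by rewrite mulr_ge0// exprn_ge0.
- by rewrite mulr_ile1 ?exprn_ge0// -normrX e1.
- apply: le_trans sumb; apply: ler_wpM2l => //.
  by apply: lerXn2r; rewrite ?nnegrE.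
Qed.

(** Taylor remainder of order [2K] at [x = u v]: as [|x| <= 3/17] and [1 - x >= 14/17], it is of
    size [(3/14)^(2K) = (9/196)^K], and the factor 2 bounds [(1 - x)^b]. *)
Lemma binomial_kernel_remainder (R : realType) (b u v : R) K :
    0 <= b <= 1 -> `|u| <= 3 / 17 -> `|v| <= 1 ->
  `|(1 - u * v) `^ b -
    \sum_(k < K.*2) left_factor (binc b) K k u * right_factor k v| <=
  2 * (9 / 196) ^+ K.
Proof.
move=> b01 ur v1; have /andP[b0 b1] := b01.
rewrite sum_factors.
have xr : `|u * v| <= 3 / 17.
  by rewrite normrM -[leRHS]mulr1; apply: ler_pM.
have Cb x : `|x| <= 3 / 17 -> (1 - x) `^ (b - K.*2%:R) <= 2 * (17 / 14) ^+ K.*2.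
  rewrite ler_norml => /andP[x1 x2].
  have x0 : 0 < 1 - x by lra.
  rewrite powRB ?(gt_eqF x0) ?implybT// powR_mulrn ?(ltW x0)//.
  apply: ler_pM; rewrite ?powR_ge0 ?invr_ge0 ?exprn_ge0 ?(ltW x0)//.
    apply: (@le_trans _ _ (2 `^ b)); last by apply: ler1_powR => //; lra.
    by apply: ge0_ler_powR; rewrite ?nnegrE//; lra.
  rewrite -exprVn; apply: lerXn2r; rewrite ?nnegrE ?invr_ge0 ?(ltW x0)//; first lra.
  rewrite -[leRHS]invrK lef_pV2 ?posrE ?invr_gt0//; last lra.
  by rewrite invf_div; lra.
have -> : \sum_(n < K.*2) binc b n * (u * v) ^+ n = (binpoly b K.*2).[u * v].
  by rewrite /binpoly horner_poly.
apply: (le_trans (binomial_remainder _ Cb xr)); first lra.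
rewrite -mulrA -[leRHS]mul1r; apply: ler_pM => //.
- by rewrite mulr_ge0 ?mulr_ge0 ?exprn_ge0//; lra.
- exact: norm_binc_le1.
rewrite -mulrA ler_wpM2l// -exprMn.
have -> : 9 / 196 = (17 / 14 * (3 / 17)) ^+ 2 :> R by field.
rewrite -exprM mul2n; apply: lerXn2r; rewrite ?nnegrE//; first by rewrite mulr_ge0//; lra.
  by lra.
by rewrite ler_wpM2l//; lra.
Qed.

(** * Upper bounds for the determinant *)

Lemma norm_det_binomial_kernel_le (R : realType) K (u v : 'I_K.+1 -> R) (b : R) :
    0 <= b <= 1 -> (forall i, `|u i| <= 3 / 17) -> (forall j, `|v j| <= 1) ->
  `|\det (\matrix_(i, j) (1 - u i * v j) `^ b)| <=
  (K.+1 ^ K.+1)%:R * (K.+1)`!%:R *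
  ((4 * K + 6)%:R ^+ K.+1 * (9 / 569) ^+ (\sum_(k < K.+1) k./2)).
Proof.
move=> b01 ur v1.
pose F k i j := left_factor (binc b) K.+1 k (u i) * right_factor k (v j).
(* The first [K] terms have rank one; the last index collects everything else, both the later terms
   of the expansion and the Taylor remainder. *)
pose T (k i j : 'I_K.+1) :=
  if (k < K)%N then F k i j else (1 - u i * v j) `^ b - \sum_(l < K) F l i j.
pose t (k : 'I_K.+1) : R := (4 * K + 6)%:R * (9 / 569) ^+ k./2.
have s0 : 0 <= 9 / 569 :> R by lra.
have s1 : 9 / 569 <= 1 :> R by lra.
have Fb k i j : `|F k i j| <= 2 * (9 / 569) ^+ k./2.
  by apply: norm_factors_le => // n; exact: norm_binc_le1.
have -> : \matrix_(i, j) (1 - u i * v j) `^ b = \matrix_(i, j) \sum_k T k i j.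
  apply/matrixP => i j; rewrite !mxE big_ord_recr /= /T ltnn.
  rewrite [X in _ = X + _](eq_bigr (fun k : 'I_K => F k i j)) => [|k _].
    by rewrite [RHS]addrC subrK.
  by rewrite /= ltn_ord.
apply: (le_trans (@norm_det_rank_one_sum_le _ _ T
  (fun k i => left_factor (binc b) K.+1 k (u i)) (fun k j => right_factor k (v j)) t _ _ _)).
- move=> k i j kmax; rewrite /T.
  by have -> : (k < K)%N by rewrite ltn_neqAle kmax -ltnS ltn_ord.
- move=> k i j; rewrite /T /t; case: ltnP => kK.
    apply: (le_trans (Fb _ _ _)); rewrite ler_wpM2r ?exprn_ge0//.
    by rewrite ler_nat; lia.
  have -> : k = K :> nat by apply/eqP; rewrite eqn_leq kK -ltnS ltn_ord.
  have rem := binomial_kernel_remainder K.+1 b01 (ur i) (v1 j).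
  have split2 : \sum_(l < K.+1.*2) F l i j =
      \sum_(l < K) F l i j + \sum_(K <= l < K.+1.*2) F l i j.
    rewrite -(big_mkord xpredT (fun l => F l i j)) -(big_mkord xpredT (fun l => F l i j)).
    by rewrite -big_cat_nat//; lia.
  rewrite -[X in `|_ - X|](addrK (\sum_(K <= l < K.+1.*2) F l i j)) -split2 opprB addrA.
  rewrite addrAC; apply: (le_trans (ler_normD _ _)).
  (* There are [K + 2] later terms, each at most [2 (9/569)^(K./2)]. With the remainder this gives
     the factor [2K + 6], which is below [4K + 6]. *)
  have tail : `|\sum_(K <= l < K.+1.*2) F l i j| <= (2 * (K + 2))%:R * (9 / 569) ^+ K./2.
    apply: (le_trans (ler_norm_sum _ _ _)).
    apply: (@le_trans _ _ (\sum_(K <= l < K.+1.*2) 2 * (9 / 569) ^+ K./2)).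
      rewrite big_nat [leRHS]big_nat; apply: ler_sum => l /andP[Kl _].
      apply: (le_trans (Fb _ _ _)); rewrite ler_wpM2l//.
      by apply: ler_wiXn2l => //; exact: half_leq.
    rewrite sumr_const_nat -mulrnAl ler_wpM2r ?exprn_ge0//.
    by rewrite -mulr_natr -natrM ler_nat; lia.
  have rem_le : 2 * (9 / 196) ^+ K.+1 <= 2 * (9 / 569) ^+ K./2 :> R.
    rewrite ler_wpM2l//.
    apply: (@le_trans _ _ ((9 / 196) ^+ (2 * K./2))).
      by apply: ler_wiXn2l; [lra|lra|]; lia.
    by rewrite exprM; apply: lerXn2r; rewrite ?nnegrE//; lra.
  have := lerD rem (lexx `|\sum_(K <= l < K.+1.*2) F l i j|).
  move=> h; apply: (le_trans h); apply: (le_trans (lerD rem_le tail)).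
  rewrite -mulrDl ler_wpM2r ?exprn_ge0// -natrD ler_nat; lia.
- move=> k; rewrite /t ler_wpM2l//; apply: ler_wiXn2l => //.
  by apply: half_leq; rewrite -ltnS.
- rewrite /t big_split /= prodr_const card_ord -expr_sum.
  exact: lexx.
Qed.

(* The Moebius coordinates are chosen so that [0, y] and [y, +oo[ are mapped into [-3/17, 3/17]
   and [-1, 1]. *)
Lemma norm_det_shifted_powers_le (R : realType) K (a c : 'I_K.+1 -> R) (b y N : R) :
    0 <= b <= 1 -> 0 < y -> (forall i, 0 < a i <= y) -> (forall j, y <= c j <= N) ->
  `|\det (\matrix_(i, j) (a i + c j) `^ b)| <=
  (4 * N `^ b) ^+ K.+1 * ((K.+1 ^ K.+1)%:R * (K.+1)`!%:R *
  ((4 * K + 6)%:R ^+ K.+1 * (9 / 569) ^+ (\sum_(k < K.+1) k./2))).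
Proof.
move=> b01 y0 ay cy; have /andP[b0 b1] := b01.
have N0 : 0 < N by have /andP[] := cy ord0; lra.
(* The identity [(a + r)(c + p) - (a - p)(c - r) = (p + r)(a + c)] factors the kernel. With these
   constants [u] runs from [-3/17] at 0 to [3/17] at [y], and [v] from [-17/18] at [y] up to 1 at
   infinity. *)
pose r := 7 / 3 * y; pose p := 7 / 17 * y.
pose u i := (a i - p) / (a i + r); pose v j := (c j - r) / (c j + p).
pose f i := ((a i + r) / (p + r)) `^ b; pose g j := (c j + p) `^ b.
have r0 : 0 < r by rewrite /r; lra.
have p0 : 0 < p by rewrite /p; lra.
have ar i : 0 < a i + r by have /andP[] := ay i; lra.
have cp j : 0 < c j + p by have /andP[] := cy j; lra.
have ur i : `|u i| <= 3 / 17.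
  have /andP[ai0 aiy] := ay i.
  rewrite /u normrM normfV (gtr0_norm (ar i)) ler_pdivrMr// ler_norml /p /r.
  by apply/andP; split; lra.
have v1 j : `|v j| <= 1.
  have /andP[cjy _] := cy j.
  rewrite /v normrM normfV (gtr0_norm (cp j)) ler_pdivrMr// ler_norml /p /r.
  by apply/andP; split; lra.
have uv i j : 0 <= 1 - u i * v j.
  rewrite subr_ge0 (le_trans (ler_norm _))// normrM mulr_ile1//.
  by apply: (le_trans (ur i)); lra.
have acE i j : (a i + c j) `^ b = f i * (1 - u i * v j) `^ b * g j.
  have h1 := ar i; have h2 := cp j.
  have f0 : 0 <= (a i + r) / (p + r) by rewrite divr_ge0//; lra.
  have fuv0 : 0 <= (a i + r) / (p + r) * (1 - u i * v j) by rewrite mulr_ge0.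
  rewrite /f /g -powRM// -powRM ?(ltW h2)//.
  congr (_ `^ _); rewrite /u /v.
  by field; apply/and3P; split; lra.
pose M := \matrix_(i, j) (1 - u i * v j) `^ b.
have -> : \matrix_(i, j) (a i + c j) `^ b =
    diag_mx (\row_i f i) *m M *m diag_mx (\row_j g j).
  by rewrite mul_diag_mx mul_mx_diag; apply/matrixP => i j; rewrite !mxE acE.
rewrite !det_mulmx !det_diag !normrM mulrAC.
apply: ler_pM => //; first by rewrite mulr_ge0.
  have -> : (4 * N `^ b) ^+ K.+1 = (\prod_(i < K.+1) 2) * (\prod_(i < K.+1) (2 * N `^ b)).
    by rewrite !prodr_const card_ord -exprMn; congr (_ ^+ _); ring.
  have b2 : 2 `^ b <= 2 :> R by apply: ler1_powR => //; lra.
  apply: ler_pM => //; rewrite normr_prod; apply: ler_prod => i _; rewrite normr_ge0 mxE /=.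
    rewrite ger0_norm ?powR_ge0//; apply: le_trans b2.
    have q0 : 0 < p + r by lra.
    apply: ge0_ler_powR; rewrite ?nnegrE ?divr_ge0 ?(ltW (ar i)) ?(ltW q0)//.
    rewrite ler_pdivrMr// /p /r; have /andP[] := ay i; lra.
  rewrite ger0_norm ?powR_ge0//.
  apply: (@le_trans _ _ ((2 * N) `^ b)); last first.
    by rewrite powRM ?(ltW N0)// ler_wpM2r ?powR_ge0.
  apply: ge0_ler_powR; rewrite ?nnegrE ?(ltW (cp i))// ?mulr_ge0 ?(ltW N0)//.
  by have /andP[] := cy i; rewrite /p; lra.
exact: norm_det_binomial_kernel_le.
Qed.

(** * Comparison of the two determinant bounds *)

Lemma expRN4_ge (R : realType) : 9 / 569 <= expR (- 4) :> R.
Proof.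
have -> : - 4 = 20%:R * (4%:R * - 20^-1) :> R by field.
rewrite expRM_natl expRM_natl -exprM.
have h : 19 / 20 <= expR (- 20^-1) :> R.
  by apply: le_trans (expR_ge1Dx _); lra.
apply: (@le_trans _ _ ((19 / 20) ^+ (4 * 20))); last first.
  by apply: lerXn2r; rewrite ?nnegrE ?expR_ge0//; lra.
(* The 80th power is taken in three stages, rounding down after each to keep the fractions small. *)
rewrite (_ : 4 * 20 = 5 * 4 * 4)%N// !exprM.
have h1 : 773 / 1000 <= (19 / 20) ^+ 5 :> R by lra.
have h2 : 357 / 1000 <= (773 / 1000) ^+ 4 :> R by lra.
have h3 : 9 / 569 <= (357 / 1000) ^+ 4 :> R by lra.
apply: (le_trans h3); apply: lerXn2r; rewrite ?nnegrE ?exprn_ge0//; [lra|lra|].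
apply: (le_trans h2); apply: lerXn2r; rewrite ?nnegrE ?exprn_ge0//; lra.
Qed.

Lemma sum_half k : (4 * (\sum_(i < k) i./2) + 2 * k = k * k + odd k)%N.
Proof.
elim: k => [|k IH]; first by rewrite big_ord0.
rewrite big_ord_recr /= mulnDr.
have := odd_double_half k; case: (odd k) IH => /=; lia.
Qed.

Lemma fact_le_expn n : (n`! <= n ^ n)%N.
Proof.
elim: n => // n IH; rewrite factS expnS leq_mul2l /=.
by apply: (leq_trans IH); case: n {IH} => // n; rewrite leq_exp2r.
Qed.

Lemma block_size_le (R : realType) K (a c : 'I_K.+1 -> R) (b y N : R) :
    0 < b < 1 -> 0 < y -> injective a -> injective c ->
    (forall i, 0 < a i <= y) -> (forall j, y <= c j <= N) ->
    (forall i j, (a i + c j) `^ b \is a Num.int) ->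
  K.+1%:R - 2 <= ln (24 * K.+1%:R ^+ 3) + b * ln N.
Proof.
move=> /andP[b0 b1] y0 ainj cinj ay cy acint.
have N0 : 0 < N by have /andP[] := cy ord0; lra.
set M := \matrix_(i, j) (a i + c j) `^ b.
have Mint : \det M \is a Num.int.
  apply: rpred_sum => s _; rewrite rpredM ?rpredX ?rpredN ?rpred1// rpred_prod// => i _.
  by rewrite mxE.
have M0 : \det M != 0.
  apply: det_shifted_powers_neq0 => //; first by rewrite gt_eqF.
    by move=> i; case/andP: (ay i).
  by move=> j; case/andP: (cy j) => h _; apply: lt_le_trans h.
have := norm_intr_ge1 Mint M0; have b01 : 0 <= b <= 1 by rewrite !ltW.
move=> /le_trans/(_ (norm_det_shifted_powers_le b01 y0 ay cy)).
set S := \sum_(k < K.+1) k./2; set k := K.+1.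
have kR : 0 < k%:R :> R by rewrite ltr0n.
(* Here [24 = 4 * 6], and the three factors [k] come from the choices of terms, from [k! <= k^k] and
   from [4K + 6 <= 6k]. *)
pose Y : R := 24 * k%:R ^+ 3 * N `^ b.
have Y0 : 0 < Y by rewrite /Y !mulr_gt0// ?exprn_gt0// powR_gt0.
move=> /le_trans/(_ (_ : _ <= Y ^+ k * expR (- 4) ^+ S)) h1.
have {h1} : 1 <= Y ^+ k * expR (- 4) ^+ S.
  apply: h1.
  have -> : Y ^+ k = (4 * N `^ b) ^+ k * ((k ^ k)%:R * (k ^ k)%:R * (6 * k)%:R ^+ k).
    by rewrite !natrX -!exprMn natrM /Y; congr (_ ^+ _); ring.
  rewrite -!mulrA ler_wpM2l ?exprn_ge0 ?mulr_ge0 ?powR_ge0// ler_wpM2l//.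
  apply: ler_pM => //; first by rewrite mulr_ge0 ?exprn_ge0//; lra.
    by rewrite ler_nat fact_le_expn.
  apply: ler_pM; rewrite ?exprn_ge0//; first lra.
    by apply: lerXn2r; rewrite ?nnegrE// ler_nat /k; lia.
  by apply: lerXn2r; rewrite ?nnegrE ?expR_ge0 ?expRN4_ge//; lra.
rewrite -{1}(lnK (_ : Y \is Num.pos)) ?posrE//.
rewrite -!expRM_natl -expRD -[X in X <= _]expR0 ler_expR => h.
(* The inequality is now [0 <= k ln Y - 4S]. As [4S >= k^2 - 2k], dividing by [k] gives
   [k - 2 <= ln Y]. *)
have lnY : ln Y = ln (24 * k%:R ^+ 3) + b * ln N.
  by rewrite /Y lnM ?posrE ?mulr_gt0 ?exprn_gt0 ?powR_gt0// ln_powR.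
rewrite -lnY -(ler_pM2l kR).
have : (4 * S + 2 * k)%:R = (k * k + odd k)%:R :> R by rewrite /S sum_half.
rewrite !natrD !natrM; have : 0 <= (odd k)%:R :> R by [].
by lra.
Qed.

(** * From perfect powers to the bound on the cardinality *)

Lemma perfect_power_root_int (R : realType) d n : (0 < d)%N ->
  perfect_power d n -> (n%:R : R) `^ d%:R^-1 \is a Num.int.
Proof.
move=> d0 [k nk].
(* The integer root may be negative when [d] is even, hence the absolute value. *)
have -> : (n%:R : R) = (`|k|%:~R) ^+ d.
  by rewrite -[n%:R]/(n%:Z%:~R) -rmorphXn /= -normrX -nk.
have k0 : 0 <= (`|k|%:~R : R) by rewrite ler0z.
rewrite -powR_mulrn// -powRrM mulfV ?pnatr_eq0 -?lt0n// powRr1//.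
Qed.

(** In the sorted list of [A], the first [K+1] entries are the [a i], the next [K+1] the [c j], and
    the entry of index [K] is the separator [y]. The blocks are disjoint, so every [a i + c j] is a
    sum of distinct elements. *)
Lemma half_card_le (R : realType) d N (A : {fset nat}) K : (2 <= d)%N ->
    (forall a : nat, a \in A -> (1 <= a <= N)%N) ->
    (forall s : nat, s \in restricted_sumset A -> perfect_power d s) ->
    (#|` A|)./2 = K.+1 ->
  K.+1%:R - 2 <= ln (24 * K.+1%:R ^+ 3 : R) + d%:R^-1 * ln N%:R.
Proof.
move=> d2 AN Apow AK.
pose s := sort leq (enum_fset A).
have us : uniq s by rewrite sort_uniq fset_uniq.
have ss : sorted leq s by exact: (sort_sorted leq_total).
have sA x : x \in s -> x \in A by rewrite mem_sort.
have sz : (K.+1 + K.+1 <= size s)%N.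
  by rewrite size_sort -[size _]/(#|` A|) addnn -AK -{2}(odd_double_half #|` A|) leq_addl.
have sn i : (i < K.+1 + K.+1)%N -> nth 0%N s i \in A.
  by move=> iK; apply/sA/mem_nth/(leq_trans iK).
have mono i j : (i <= j)%N -> (j < K.+1 + K.+1)%N -> (nth 0 s i <= nth 0 s j)%N.
  move=> ij jK; apply: (sorted_leq_nth leq_trans leqnn 0%N ss) => //; rewrite inE.
    exact/(leq_trans _ sz)/(leq_ltn_trans ij).
  exact: leq_trans sz.
have inj i j : (i < K.+1 + K.+1)%N -> (j < K.+1 + K.+1)%N ->
    nth 0%N s i = nth 0%N s j -> i = j.
  move=> iK jK /eqP; rewrite nth_uniq ?(leq_trans iK) ?(leq_trans jK)//.
  by move/eqP.
pose a (i : 'I_K.+1) : R := (nth 0 s i)%:R.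
pose c (j : 'I_K.+1) : R := (nth 0 s (K.+1 + j))%:R.
have iK (i : 'I_K.+1) : (i < K.+1 + K.+1)%N by have := ltn_ord i; lia.
have jK (j : 'I_K.+1) : (K.+1 + j < K.+1 + K.+1)%N by have := ltn_ord j; lia.
have d1 : 1 < d%:R :> R by rewrite ltr1n.
have d1' : 0 < d%:R :> R by lra.
apply: (@block_size_le _ _ a c d%:R^-1 (nth 0 s K)%:R).
- by rewrite invr_gt0 d1' invf_lt1.
- by rewrite ltr0n; case/andP: (AN _ (sn K (iK ord_max))).
- by move=> i j /eqP; rewrite eqr_nat => /eqP/inj => /(_ (iK _) (iK _)) /val_inj.
- by move=> i j /eqP; rewrite eqr_nat => /eqP/inj => /(_ (jK _) (jK _)) /addnI/val_inj.
- move=> i; have /andP[h _] := AN _ (sn i (iK i)).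
  by rewrite ltr0n h ler_nat mono// ?(iK ord_max)// -ltnS ltn_ord.
- move=> j; have /andP[_ h] := AN _ (sn _ (jK j)).
  by rewrite !ler_nat h andbT mono// ?jK//; lia.
- move=> i j; rewrite -natrD; apply: perfect_power_root_int; first by lia.
  apply: Apow; apply/restricted_sumsetP.
  exists (nth 0 s i)%N, (nth 0 s (K.+1 + j))%N; split; rewrite ?sn//.
  by apply/eqP => /inj => /(_ (iK _) (jK _)); have := ltn_ord i; lia.
Qed.

(** The slope [e] can be arbitrarily small, so the logarithmic loss [3 ln k] costs only a small
    multiple of [k]. *)
Lemma ln_le_linear (R : realType) (e x : R) : 0 < e -> 0 < x -> ln x <= e * x - ln e.
Proof.
move=> e0 x0; rewrite lerBrDr -lnM ?posrE// mulrC.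
by apply/ltW/ln_sublinear; rewrite mulr_gt0.
Qed.

Theorem theorem1p8 (R : realType) (d : nat) (hd : (2 <= d)%N)
    (eps : R) (heps : 0 < eps) :
  exists N0 : nat, forall N : nat, (N0 <= N)%N ->
    forall A : {fset nat},
      (forall a : nat, a \in A -> (1 <= a <= N)%N) ->
      (forall s : nat, s \in restricted_sumset A -> perfect_power d s) ->
      (#|` A|)%:R <= (2 + eps) * (totient d)%:R / d%:R * ln (N%:R : R).
Proof.
have d0 : 0 < d%:R :> R by rewrite ltr0n; lia.
(* This makes [2 / (1 - 3e) = 4 (2 + eps) / (4 + eps)], strictly less than [2 + eps]; the gap
   absorbs the constants. *)
have [e [e0 e1 eE]] : exists e : R,
    [/\ 0 < e, e < 1 & (2 * (2 + eps)) * (1 - 3 * e) = 4 + eps].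
  exists (eps / (6 * (2 + eps))); split.
  - by rewrite divr_gt0// mulr_gt0//; lra.
  - by rewrite ltr_pdivrMr ?mulr_gt0//; lra.
  - by field; lra.
pose C := 2 + ln 24 - 3 * ln e.
have C0 : 0 <= C.
  have l24 : 0 <= ln 24 :> R by rewrite ln_ge0//; lra.
  by have := ln_le0 (ltW e1); rewrite /C; lra.
(* The least [L] with [4 (2 + eps) (L + C) + (4 + eps) <= (4 + eps) (2 + eps) L], where [L] stands
   for [ln N / d]. *)
pose L0 := (4 * (2 + eps) * C + (4 + eps)) / ((2 + eps) * eps).
have L00 : 0 <= L0.
  by rewrite divr_ge0 ?addr_ge0 ?mulr_ge0//; lra.
exists (Num.truncn (expR (d%:R * L0))).+1 => N NN0 A AN Apow.
have expN : expR (d%:R * L0) <= N%:R.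
  apply/ltW; apply: (lt_le_trans (truncnS_gt _)).
  by rewrite ler_nat.
have N0 : 0 < N%:R :> R by apply: lt_le_trans expN; exact: expR_gt0.
pose L := d%:R^-1 * ln N%:R : R.
have LL0 : L0 <= L.
  by rewrite /L mulrC ler_pdivlMr// mulrC -ler_expR lnK ?posrE.
pose n := #|` A|.
have kL : (1 - 3 * e) * n./2%:R <= L + C.
  case K : n./2 => [|k]; first by rewrite mulr0 addr_ge0// (le_trans L00).
  have := half_card_le R hd AN Apow K; rewrite -/L.
  have k0 : 0 < k.+1%:R :> R by rewrite ltr0n.
  rewrite lnM ?posrE ?exprn_gt0// lnXn//.
  have := ln_le_linear e0 k0; rewrite /C mulrBl -mulrA.
  rewrite mul1r.
  have lin (x y z w t r : R) : y <= z - w -> x - 2 <= t + y *+ 3 + r ->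
      x - 3 * z <= r + (2 + t - 3 * w) by lra.
  exact: lin.
(* The extra 1 accounts for the middle element when [n] is odd. *)
have nk : n%:R <= 2 * n./2%:R + 1 :> R.
  by rewrite -{1}(odd_double_half n) natrD -mul2n natrM addrC lerD2l lern1 leq_b1.
have nL : n%:R <= (2 + eps) * L.
  have h : 0 < 4 + eps by lra.
  have e3 : 0 < 2 + eps by lra.
  rewrite -(ler_pM2l h).
  have : (4 + eps) * (2 * n./2%:R) <= 4 * (2 + eps) * (L + C).
    rewrite -eE.
    have := ler_wpM2l (_ : 0 <= 4 * (2 + eps)) kL; rewrite mulr_ge0//; last by lra.
    by move=> /(_ isT); lra.
  have : 4 * (2 + eps) * C + (4 + eps) <= L * ((2 + eps) * eps).
    by rewrite -ler_pdivrMr// mulr_gt0.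
  have := ler_wpM2l (ltW h) nk.
  by lra.
apply: (le_trans nL).
rewrite -mulrA -mulrA ler_wpM2l//; first by lra.
rewrite -/L -{1}[L]mul1r ler_wpM2r ?(le_trans L00)//.
by rewrite ler1n totient_gt0; lia.
Qed.
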